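(* Consider the smart-meter system with infinite battery capacity ($B_{\max}=\infty$) and peak power constraint $\hat P\ge\bar P_E=\mathbb{E}[E]$. Let $$\mathcal{I}^i(\infty,\hat P)=\inf_{f\in\mathcal F}\limsup_{n\to\infty}\frac1n I(X^n;Y^n),\qquad \bar{\mathcal{I}}^i(\infty,\hat P)=\inf_{f\in\mathcal F}\limsup_{n\to\infty}\frac1n I(X^n;Y^n\mid E^n)$$ be the minimum information leakage rates when the renewable energy sequence $E^n$ is, respectively, not known and known to the utility provider. Then $\bar{\mathcal{I}}^i(\infty,\hat P)=\mathcal{I}^i(\infty,\hat P)$.
   Context: Alphabets: $\mathcal X=\mathcal Y=\{0,1,\dots,X_{\max}\}$, $\mathcal E=\{0,1,\dots,E_{\max}\}$. The input load $(X_t)_{t\ge1}$ is i.i.d. with distribution $p_X$ on $\mathcal X$; the renewable energy $(E_t)_{t\ge 1}$ is i.i.d. with distribution $p_E$ on $\mathcal E$; the two sequences are independent. $X^n=(X_1,\dots,X_n)$, and similarly for the other sequences. $I$ denotes (conditional) mutual information. Battery: state of charge $B_t$ with $B_1=0$ and, since the capacity is infinite, $B_{t+1}=B_t+E_t-(X_t-Y_t)$. A (possibly randomized) causal energy management policy $f=(f_t)_{t\ge1}$ selects, at each time $t$, the output load $Y_t\in\mathcal Y$ as a function of $(X^t,E^t,B^t,Y^{t-1})$ and private randomness, i.e. according to a conditional distribution given $(X^t,E^t,B^t,Y^{t-1})$; the pairs $(X_s,E_s)$, $s>t$, are independent of everything up to and including time $t$. The policy is feasible ($f\in\mathcal F$)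 if almost surely, for all $t$, $0\le X_t-Y_t\le \min\{B_t+E_t,\hat P\}$. *)

(* Defs.v *)
From HB Require Import structures.
From mathcomp Require Export all_boot all_order all_algebra.
From mathcomp Require Export all_classical all_reals all_analysis.
Export Order.TTheory GRing.Theory Num.Theory.

#[export] Set Implicit Arguments.
#[export] Unset Strict Implicit.
#[export] Unset Printing Implicit Defensive.

Global Open Scope classical_set_scope.
Global Open Scope ring_scope.

Record dist (R : realType) (A : finType) := Dist {
  pmf :> A -> R ;
  pmf_ge0 : forall a, 0 <= pmf a ;
  pmf_sum1 : \sum_(a : A) pmf a = 1
}.

(* Information is measured in nats.  Terms with zero joint probability vanish,
   because of the factor in front of the logarithm. *)
Definition mutual_info (R : realType) (A B : finType) (p : A -> B -> R) : R :=
  \sum_(a : A) \sum_(b : B)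
    p a b * ln (p a b / ((\sum_(b' : B) p a b') * (\sum_(a' : A) p a' b))).

(* I(A; B | C) for the joint pmf p a b c. *)
Definition cond_mutual_info (R : realType) (A B C : finType)
    (p : A -> B -> C -> R) : R :=
  \sum_(c : C) \sum_(a : A) \sum_(b : B)
    p a b c *
    ln ((p a b c * (\sum_(a' : A) \sum_(b' : B) p a' b' c))
        / ((\sum_(b' : B) p a b' c) * (\sum_(a' : A) p a' b c))).

Section SmartMeter.
Variables (R : realType) (Xmax Emax : nat).

(* The output load takes its values in the same alphabet as the input load. *)
Definition load := 'I_Xmax.+1.
Definition energy := 'I_Emax.+1.

(* Time is counted from 0.  [f t xs es bs ys] is the conditional law of the
   output load at time t; it is only ever used with xs, es, bs of size t.+1
   (values up to and including time t) and ys of size t (strictly past outputs);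
   its values on lists of other sizes are irrelevant. *)
Definition policy :=
  nat -> seq load -> seq energy -> seq int -> seq load -> dist R load.

(* Battery state at the beginning of slot t, with infinite capacity.  It is an
   integer for arbitrary trajectories, and nonnegative for feasible policies. *)
Fixpoint battery (xs : seq load) (es : seq energy) (ys : seq load) (t : nat)
    : int :=
  if t is s.+1 then
    battery xs es ys s + (nth ord0 es s)%:Z
      - ((nth ord0 xs s)%:Z - (nth ord0 ys s)%:Z)
  else 0.

Definition battery_history xs es ys (t : nat) : seq int :=
  [seq battery xs es ys s | s <- iota 0 t.+1].

Definition joint_law (pX : dist R load) (pE : dist R energy) (f : policy)
    (n : nat) (x : n.-tuple load) (e : n.-tuple energy) (y : n.-tuple load) : R :=
  \prod_(t < n)
    (pX (tnth x t) * pE (tnth e t)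
     * f t (take t.+1 x) (take t.+1 e) (battery_history x e y t) (take t y)
         (tnth y t)).

(* Almost-sure feasibility: the variables are discrete and there are countably
   many times, so it says that every finite trajectory of positive probability
   satisfies the constraint at each of its times. *)
Definition feasible pX pE (Phat : R) (f : policy) : Prop :=
  forall (n : nat) (x : n.-tuple load) (e : n.-tuple energy) (y : n.-tuple load),
    0 < joint_law pX pE f x e y ->
    forall t : 'I_n,
      let drawn : int := (tnth x t)%:Z - (tnth y t)%:Z in
      0 <= drawn%:~R :> R /\
      drawn%:~R <=
        Num.min (battery x e y t + (tnth e t)%:Z)%:~R Phat.

Definition info_unknown pX pE (f : policy) (n : nat) : R :=
  mutual_info (fun x y : n.-tuple load =>
    \sum_(e : n.-tuple energy) joint_law pX pE f x e y).

Definition info_known pX pE (f : policy) (n : nat) : R :=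
  cond_mutual_info (fun (x y : n.-tuple load) (e : n.-tuple energy) =>
    joint_law pX pE f x e y).

(* The term of index n = 0 is 0 and does not affect the limit superior. *)
Definition rate_unknown pX pE (f : policy) : \bar R :=
  limn_esup (fun n => (n%:R^-1 * info_unknown pX pE f n)%:E).

Definition rate_known pX pE (f : policy) : \bar R :=
  limn_esup (fun n => (n%:R^-1 * info_known pX pE f n)%:E).

Definition min_leakage_unknown pX pE (Phat : R) : \bar R :=
  ereal_inf [set rate_unknown pX pE f | f in feasible pX pE Phat].

Definition min_leakage_known pX pE (Phat : R) : \bar R :=
  ereal_inf [set rate_known pX pE f | f in feasible pX pE Phat].

Definition mean_energy (pE : dist R energy) : R :=
  \sum_(e : energy) (e : nat)%:R * pE e.

End SmartMeter.

(* Main.v *)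
Require Import Defs.
From mathcomp Require Import ring lra.

(* Knowing E^n can only increase the leakage of a given policy, because X^n and
   E^n are independent.

   Conversely, let f be feasible and let p be the time average over n slots of
   the joint laws of (X_t, Y_t).  Its first marginal is pX, its support satisfies
   0 <= a - c <= Phat, the battery can never deliver more than was harvested so
   that the mean of a - c under p is at most E[E], and I(p) <= I(X^n; Y^n) / n: the
   divergence of the law of (X^n, Y^n) from the law obtained from that of Y^n by
   the memoryless reverse channel of p is nonnegative.

   Mix the channel of p with a little of the identity and use it whenever the
   battery holds at least Xmax, drawing nothing otherwise.  This is feasible, and
   the mixture leaves the battery a positive drift (if E[E] > 0), so that
   E[exp (- s B_t)] decays geometrically for some s > 0 and the expected number of
   slots with a low battery is bounded.  Comparing the law of Y^n given E^n with
   the i.i.d. output law of the channel bounds I(X^n; Y^n | E^n) by n times the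
   information of the channel, plus a constant.  If E[E] = 0 then p is diagonal
   and the policy always outputs its input. *)

(** * Information inequalities *)

Section Information.
Variable R : realType.

(** The tangent bound [ln u <= u - 1] at [u = c / a], multiplied by [a]; for [a = 0] it reduces to
    [- c <= 0]. *)
Lemma ln_ratio_ge (a c : R) : 0 <= a -> 0 <= c -> (0 < a -> 0 < c) ->
  a - c <= a * ln (a / c).
Proof.
move=> a0 c0 ac; have [a_gt0|] := ltP 0 a; last first.
  by move=> a_le0; have -> : a = 0 by [lra]; rewrite mul0r; lra.
have c_gt0 := ac a_gt0.
have : ln (c / a) <= c / a - 1.
  rewrite -[X in ln X](_ : 1 + (c / a - 1) = _); last by ring.
  apply: le_ln1Dx; have := divr_gt0 c_gt0 a_gt0; lra.
rewrite -[c / a]invf_div lnV; last by rewrite posrE divr_gt0.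
rewrite invf_div => /(ler_wpM2l a0).
rewrite mulrN mulrBr mulr1 mulrCA divff ?gt_eqF// mulr1; lra.
Qed.

(** Nonnegativity of relative entropy. Asking only that [q] has no more mass than [p] allows reverse
    channels whose columns vanish at outputs of probability zero. *)
Lemma gibbs (T : finType) (p q : T -> R) :
  (forall i, 0 <= p i) -> (forall i, 0 <= q i) -> \sum_i q i <= \sum_i p i ->
  (forall i, 0 < p i -> 0 < q i) -> 0 <= \sum_i p i * ln (p i / q i).
Proof.
move=> p0 q0 qp pq; apply: (@le_trans _ _ (\sum_i (p i - q i))).
  by rewrite sumrB subr_ge0.
by apply: ler_sum => i _; apply: ln_ratio_ge => //; exact: pq.
Qed.

(** The two-term log-sum inequality, from which convexity of the information in the channel is
    derived later. *)
Lemma log_sum (a b c d : R) : 0 <= a -> 0 <= b -> 0 <= c -> 0 <= d ->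
  (0 < a -> 0 < c) -> (0 < b -> 0 < d) ->
  (a + b) * ln ((a + b) / (c + d)) <= a * ln (a / c) + b * ln (b / d).
Proof.
move=> a0 b0 c0 d0 ac bd.
have [s_le0|s_gt0] := leP (a + b) 0.
  have [-> ->] : a = 0 /\ b = 0 by split; lra.
  by rewrite addr0 !mul0r addr0.
have S_gt0 : 0 < c + d.
  have [a_le0|/ac c_gt0] := leP a 0; last by lra.
  have d_gt0 : 0 < d by apply: bd; lra.
  by lra.
set k := (a + b) / (c + d).
have k_gt0 : 0 < k by rewrite divr_gt0.
have kE : (c + d) * k = a + b by rewrite mulrC divfK // gt_eqF.
clearbody k.
(* This is [ln_ratio_ge] for [u] and [v * k], with [k] the pooled ratio. In the sum of its two
   instances the linear terms cancel, since [(c + d) * k = a + b]. *)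
have main u v : 0 <= u -> 0 <= v -> (0 < u -> 0 < v) ->
    u * ln k + u - v * k <= u * ln (u / v).
  move=> u0 v0 uv; have := @ln_ratio_ge u (v * k) u0 (mulr_ge0 v0 (ltW k_gt0)).
  have [u_le0|u_gt0] := leP u 0.
    have -> : u = 0 by lra.
    by move=> _; have := mulr_ge0 v0 (ltW k_gt0); lra.
  have v_gt0 := uv u_gt0.
  move=> /(_ (fun _ => mulr_gt0 v_gt0 k_gt0)).
  by rewrite !ln_div ?posrE ?mulr_gt0 // lnM ?posrE //; lra.
have := main a c a0 c0 ac; have := main b d b0 d0 bd.
lra.
Qed.

Lemma ln_prod n (F : 'I_n -> R) : (forall t, 0 < F t) ->
  ln (\prod_t F t) = \sum_t ln (F t).
Proof.
move=> F0; suff [_ ->] : 0 < \prod_t F t /\ ln (\prod_t F t) = \sum_t ln (F t) by [].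
apply: (big_rec2 (fun u v => 0 < u /\ ln u = v)); first by rewrite ltr01 ln1.
by move=> i u v _ [v0 <-]; rewrite mulr_gt0 // lnM ?posrE.
Qed.

Lemma sum_gt0P (T : finType) (F : T -> R) : (forall i, 0 <= F i) ->
  0 < \sum_i F i -> exists i, 0 < F i.
Proof.
move=> F0 S; apply/existsP; apply: contraLR S => /existsPn h.
rewrite -leNgt; apply: sumr_le0 => i _; by rewrite leNgt.
Qed.

Lemma sum_gt0 (T : finType) (F : T -> R) i : (forall j, 0 <= F j) ->
  0 < F i -> 0 < \sum_j F j.
Proof.
move=> F0 Fi; rewrite (bigD1 i) //=; apply: ltr_pwDl => //.
by apply: sumr_ge0.
Qed.

(* V is an arbitrary reverse channel from B to A. *)
Lemma mutual_info_ge (A B : finType) (p : A -> B -> R) (V : A -> B -> R) :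
  (forall a b, 0 <= p a b) -> (forall a b, 0 <= V a b) ->
  (forall b, \sum_a V a b <= 1) -> (forall a b, 0 < p a b -> 0 < V a b) ->
  \sum_a \sum_b p a b * ln (V a b / \sum_b' p a b') <= mutual_info p.
Proof.
move=> p0 V0 V1 pV; rewrite /mutual_info -subr_ge0 -sumrB.
under eq_bigr do rewrite -sumrB.
rewrite pair_bigA /=.
have pB0 b : 0 <= \sum_a p a b by apply: sumr_ge0.
have pBgt0 a b : 0 < p a b -> 0 < \sum_a' p a' b by move=> h; apply: sum_gt0 h.
have pAgt0 a b : 0 < p a b -> 0 < \sum_b' p a b' by move=> h; apply: sum_gt0 h.
(* The gap is the divergence of [p] from the law that draws [b] from its marginal and then [a] from
   [V]. *)
pose P (i : A * B) := p i.1 i.2.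
pose Q (i : A * B) := (\sum_a' p a' i.2) * V i.1 i.2.
rewrite (eq_bigr (fun i => P i * ln (P i / Q i))); last first.
  move=> [a b] _ /=; rewrite /P /Q /= -mulrBr.
  have [p_gt0|p_le0] := ltP 0 (p a b); last first.
    have -> : p a b = 0 by apply/eqP; rewrite eq_le p_le0 p0.
    by rewrite !mul0r.
  congr (_ * _).
  have h1 := pBgt0 _ _ p_gt0; have h2 := pAgt0 _ _ p_gt0; have h3 := pV _ _ p_gt0.
  rewrite !ln_div ?posrE ?mulr_gt0 //.
  rewrite !lnM ?posrE //; lra.
apply: gibbs.
- by move=> [a b]; exact: p0.
- by move=> [a b]; rewrite /Q mulr_ge0.
- rewrite -(pair_bigA _ (fun a b => Q (a, b))) -(pair_bigA _ (fun a b => P (a, b))) /=.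
  rewrite exchange_big [leRHS]exchange_big /=; apply: ler_sum => b _.
  by rewrite /Q /P /= -mulr_sumr ler_piMr.
- by move=> [a b] h; rewrite /Q /= mulr_gt0 // ?pV // (pBgt0 a).
Qed.

(* Q is an arbitrary output law, which need not depend on C. *)
Lemma cond_mutual_info_le (A B C : finType) (p : A -> B -> C -> R) (Q : B -> R) :
  (forall a b c, 0 <= p a b c) -> (forall b, 0 <= Q b) -> \sum_b Q b <= 1 ->
  (forall a b c, 0 < p a b c -> 0 < Q b) ->
  cond_mutual_info p <=
  \sum_c \sum_a \sum_b p a b c * ln (p a b c / ((\sum_b' p a b' c) * Q b)).
Proof.
move=> p0 Q0 Q1 pQ; rewrite /cond_mutual_info; apply: ler_sum => c _.
rewrite -subr_ge0 -sumrB.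
under eq_bigr do rewrite -sumrB.
rewrite exchange_big /=.
have pB0 b : 0 <= \sum_a p a b c by apply: sumr_ge0.
have pBgt0 a b : 0 < p a b c -> 0 < \sum_a' p a' b c.
  by move=> h; apply: (sum_gt0 (F := fun a => p a b c)) h.
have pAgt0 a b : 0 < p a b c -> 0 < \sum_b' p a b' c by move=> h; apply: sum_gt0 h.
have pCgt0 a b : 0 < p a b c -> 0 < \sum_a' \sum_b' p a' b' c.
  move=> /pAgt0 h; apply: sum_gt0 h => a'; exact: sumr_ge0.
(* For each [c], the gap is the divergence of the output masses [P] from [Q] scaled to the mass of
   [c]. *)
pose P b := \sum_a p a b c.
pose q b := (\sum_a' \sum_b' p a' b' c) * Q b.
rewrite (eq_bigr (fun b => P b * ln (P b / q b))); last first.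
  move=> b _; rewrite /P /q mulr_suml; apply: eq_bigr => a _; rewrite -mulrBr.
  have [p_gt0|p_le0] := ltP 0 (p a b c); last first.
    have -> : p a b c = 0 by apply/eqP; rewrite eq_le p_le0 p0.
    by rewrite !mul0r.
  congr (_ * _).
  have h1 := pBgt0 _ _ p_gt0; have h2 := pAgt0 _ _ p_gt0.
  have h3 := pCgt0 _ _ p_gt0; have h4 := pQ _ _ _ p_gt0.
  rewrite !ln_div ?posrE ?mulr_gt0 //.
  rewrite !lnM ?posrE //; lra.
have pC0 : 0 <= \sum_a' \sum_b' p a' b' c.
  by apply: sumr_ge0 => a' _; exact: sumr_ge0.
apply: gibbs => //.
- by move=> b; rewrite /q mulr_ge0.
- by rewrite /q -mulr_sumr /P [leRHS]exchange_big /= ler_piMr.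
- move=> b /sum_gt0P [//|a h]; rewrite /q mulr_gt0 ?(pQ _ _ _ h) //.
  exact: pCgt0 h.
Qed.

(* When A and C are independent, I(A; B | C) = I(A; B, C). *)
Lemma mutual_info_le_cond (A B C : finType) (p : A -> B -> C -> R)
    (pA : A -> R) (pC : C -> R) :
  (forall a b c, 0 <= p a b c) -> (forall a, 0 <= pA a) -> (forall c, 0 <= pC c) ->
  \sum_a pA a = 1 -> \sum_c pC c = 1 ->
  (forall a c, \sum_b p a b c = pA a * pC c) ->
  mutual_info (fun a b => \sum_c p a b c) <= cond_mutual_info p.
Proof.
move=> p0 pA0 pC0 pA1 pC1 pAC.
have pAB0 a b : 0 <= \sum_c p a b c by apply: sumr_ge0.
have pBC0 b c : 0 <= \sum_a p a b c by apply: sumr_ge0.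
have pB0 b : 0 <= \sum_a \sum_c p a b c by apply: sumr_ge0.
have pA_marg a : \sum_b \sum_c p a b c = pA a.
  rewrite exchange_big /=; under eq_bigr do rewrite pAC.
  by rewrite -mulr_sumr pC1 mulr1.
have pC_marg c : \sum_a \sum_b p a b c = pC c.
  by under eq_bigr do rewrite pAC; rewrite -mulr_suml pA1 mul1r.
have pABgt0 a b c : 0 < p a b c -> 0 < \sum_c' p a b c'.
  by move=> h; apply: sum_gt0 h.
have pBCgt0 a b c : 0 < p a b c -> 0 < \sum_a' p a' b c.
  by move=> h; apply: (sum_gt0 (F := fun a => p a b c)) h.
have pBgt0 a b c : 0 < p a b c -> 0 < \sum_a' \sum_c' p a' b c'.
  by move=> /pABgt0 h; apply: (sum_gt0 (F := fun a => \sum_c p a b c)) h.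
have pACgt0 a b c : 0 < p a b c -> 0 < pA a /\ 0 < pC c.
  move=> h; have : 0 < \sum_b' p a b' c by apply: sum_gt0 h.
  rewrite pAC => h'; split; rewrite lt0r ?pA0 ?pC0 andbT;
    by apply: contraTneq h' => ->; rewrite ?mul0r ?mulr0 ltxx.
(* By independence of A and C the gap equals I(A; C | B): the divergence of [p] from the law [Q]
   that makes A and C conditionally independent given B. *)
pose P (i : A * B * C) := p i.1.1 i.1.2 i.2.
pose Q (i : A * B * C) := (\sum_a p a i.1.2 i.2) *
  ((\sum_c p i.1.1 i.1.2 c) / \sum_a \sum_c p a i.1.2 c).
rewrite -subr_ge0.
have -> : cond_mutual_info p - mutual_info (fun a b => \sum_c p a b c) =
    \sum_i P i * ln (P i / Q i).
  rewrite /cond_mutual_info /mutual_info exchange_big /=.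
  under eq_bigr do rewrite exchange_big /=.
  rewrite -sumrB; under [LHS]eq_bigr do rewrite -sumrB.
  rewrite pair_bigA /=.
  under [LHS]eq_bigr do rewrite mulr_suml -sumrB.
  rewrite pair_bigA /=; apply: eq_bigr => -[[a b] c] _ /=.
  rewrite /P /Q /= -mulrBr.
  have [p_gt0|p_le0] := ltP 0 (p a b c); last first.
    have -> : p a b c = 0 by apply/eqP; rewrite eq_le p_le0 p0.
    by rewrite !mul0r.
  congr (_ * _); rewrite pC_marg pAC pA_marg.
  have [h1 h2] := pACgt0 _ _ _ p_gt0.
  have h3 := pABgt0 _ _ _ p_gt0; have h4 := pBCgt0 _ _ _ p_gt0.
  have h5 := pBgt0 _ _ _ p_gt0.
  rewrite !ln_div ?posrE ?mulr_gt0 ?divr_gt0 ?invr_gt0 //.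
  rewrite !lnM ?posrE ?divr_gt0 ?mulr_gt0 ?invr_gt0 // lnV ?posrE //; lra.
apply: gibbs.
- by move=> [[a b] c]; exact: p0.
- by move=> [[a b] c]; rewrite /Q mulr_ge0 ?divr_ge0.
- have sum3 (F : A * B * C -> R) : \sum_i F i = \sum_b \sum_c \sum_a F (a, b, c).
    rewrite (eq_bigr (fun i => F (i.1.1, i.1.2, i.2))); last by move=> [[]].
    rewrite -(pair_bigA _ (fun i c => F (i.1, i.2, c))) /=.
    rewrite -(pair_bigA _ (fun a b => \sum_c F (a, b, c))) exchange_big /=.
    by apply: eq_bigr => b _; rewrite exchange_big.
  rewrite !sum3 /Q /P /=; apply: ler_sum => b _; apply: ler_sum => c _.
  rewrite -mulr_sumr -mulr_suml ler_piMr //.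
  have [->|nz] := eqVneq (\sum_a \sum_c p a b c) 0; first by rewrite mul0r.
  by rewrite divff.
- move=> [[a b] c] h; rewrite /Q /= mulr_gt0 ?divr_gt0 //.
  + exact: pBCgt0 h.
  + exact: pABgt0 h.
  + exact: pBgt0 h.
Qed.

End Information.

(** * Expectations over trajectories *)

Lemma sum_rcons_tuple (R : nmodType) (T : finType) n (F : n.+1.-tuple T -> R) :
  \sum_x F x = \sum_(x : n.-tuple T) \sum_a F (rcons_tuple x a).
Proof.
rewrite pair_bigA /= (reindex (fun p : n.-tuple T * T => rcons_tuple p.1 p.2)) //=.
apply: onW_bij; apply: inj_card_bij.
  move=> [x a] [y c] /(congr1 (@tval _ _)) /rcons_inj[xy ->].
  by congr pair; exact: val_inj.
by rewrite card_prod !card_tuple expnSr.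
Qed.

Lemma sum_tuple0 (R : nmodType) (T : finType) (F : 0.-tuple T -> R) :
  \sum_x F x = F [tuple].
Proof.
by rewrite (big_pred1 [tuple]) // => x; apply/esym/eqP; exact: tuple0.
Qed.

Lemma tnth_rconsl (T : Type) n (z : n.-tuple T) d (t : 'I_n) :
  tnth (rcons_tuple z d) (widen_ord (leqnSn n) t) = tnth z t.
Proof. by rewrite !(tnth_nth d) /= nth_rcons size_tuple ltn_ord. Qed.

Lemma tnth_rconsr (T : Type) n (z : n.-tuple T) d :
  tnth (rcons_tuple z d) ord_max = d.
Proof. by rewrite (tnth_nth d) /= nth_rcons size_tuple ltnn; case: ifP. Qed.

Lemma sum_tuple_prod (R : comPzSemiRingType) (T : finType) n (F : nat -> T -> R) :
  \sum_(x : n.-tuple T) \prod_(t < n) F t (tnth x t) = \prod_(t < n) \sum_a F t a.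
Proof.
elim: n => [|n IH]; first by rewrite sum_tuple0 !big_ord0.
rewrite sum_rcons_tuple big_ord_recr /= -IH mulr_suml; apply: eq_bigr => x _.
rewrite mulr_sumr; apply: eq_bigr => a _; rewrite big_ord_recr /=.
rewrite tnth_rconsr; congr (_ * _).
by apply: eq_bigr => t _; rewrite tnth_rconsl.
Qed.

Section Expectation.
Variables (R : realType) (Xmax Emax : nat).
Variables (pX : dist R (load Xmax)) (pE : dist R (energy Emax)).
Variable f : policy R Xmax Emax.
Implicit Types (a c : load Xmax) (b : energy Emax).

Lemma battery_rcons (x : seq (load Xmax)) (e : seq (energy Emax)) y a b c n s :
  size x = n -> size e = n -> size y = n -> (s <= n)%N ->
  battery (rcons x a) (rcons e b) (rcons y c) s = battery x e y s.
Proof.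
move=> sx se sy; elim: s => //= s IH sn; rewrite IH; last exact: ltnW.
by rewrite !nth_rcons sx se sy sn.
Qed.

Lemma batteryS (n : nat) (x : n.-tuple (load Xmax)) (e : n.-tuple (energy Emax))
    (y : n.-tuple (load Xmax)) a b c :
  battery (rcons x a) (rcons e b) (rcons y c) n.+1 =
  battery x e y n + b%:Z - (a%:Z - c%:Z).
Proof.
rewrite /= (@battery_rcons _ _ _ _ _ _ n) ?size_tuple //.
by rewrite !nth_rcons !size_tuple ltnn eqxx.
Qed.

Lemma joint_law_ge0 n (x : n.-tuple (load Xmax)) (e : n.-tuple (energy Emax)) y :
  0 <= joint_law pX pE f x e y.
Proof. by apply: prodr_ge0 => t _; rewrite !mulr_ge0 ?pmf_ge0. Qed.

(** The factors of index below [n] read only prefixes of the trajectory, so the appended symbols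
    leave them unchanged. *)
Lemma joint_law_rcons n (x : n.-tuple (load Xmax)) (e : n.-tuple (energy Emax)) y
    a b c :
  joint_law pX pE f (rcons_tuple x a) (rcons_tuple e b) (rcons_tuple y c) =
  joint_law pX pE f x e y *
  (pX a * pE b * f n (rcons x a) (rcons e b) (battery_history x e y n) y c).
Proof.
have hist s : (s <= n)%N -> battery_history (rcons x a) (rcons e b) (rcons y c) s
    = battery_history x e y s.
  move=> sn; apply/eq_in_map => u; rewrite mem_iota /= add0n ltnS => us.
  by rewrite (@battery_rcons _ _ _ _ _ _ n) ?size_tuple // (leq_trans us).
have tk (T : Type) (z : n.-tuple T) d s : (s <= n)%N -> take s (rcons z d) = take s z.
  by move=> sn; rewrite -cats1 takel_cat // size_tuple.
rewrite /joint_law big_ord_recr /=; congr (_ * _).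
  apply: eq_bigr => t _; rewrite !tnth_rconsl.
  by rewrite !tk ?ltn_ord // ?hist // ltnW.
rewrite !tnth_rconsr hist // [take n (rcons y c)]tk // [take n y]take_oversize ?size_tuple //.
by rewrite ![take n.+1 _]take_oversize ?size_rcons ?size_tuple.
Qed.

Definition expect n
    (G : n.-tuple (load Xmax) -> n.-tuple (energy Emax) -> n.-tuple (load Xmax) -> R)
    : R :=
  \sum_x \sum_e \sum_y joint_law pX pE f x e y * G x e y.

Lemma expect0 G : expect (n := 0) G = G [tuple] [tuple] [tuple].
Proof. by rewrite /expect !sum_tuple0 /joint_law big_ord0 mul1r. Qed.

(** Conditioning on the first [n] slots. Inductions over time on expectations go through this
    one-step form. *)
Lemma expectS n G : expect (n := n.+1) G = expect (n := n) (fun x e y =>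
  \sum_a \sum_b \sum_c
    pX a * pE b * f n (rcons x a) (rcons e b) (battery_history x e y n) y c *
    G (rcons_tuple x a) (rcons_tuple e b) (rcons_tuple y c)).
Proof.
rewrite /expect sum_rcons_tuple; apply: eq_bigr => x _.
under eq_bigr do rewrite sum_rcons_tuple; rewrite exchange_big; apply: eq_bigr => e _.
under eq_bigr do under eq_bigr do rewrite sum_rcons_tuple.
under eq_bigr do rewrite exchange_big; rewrite exchange_big /=; apply: eq_bigr => y _.
rewrite mulr_sumr; apply: eq_bigr => a _.
rewrite mulr_sumr; apply: eq_bigr => b _.
rewrite mulr_sumr; apply: eq_bigr => c _.
by rewrite joint_law_rcons -!mulrA.
Qed.

Lemma le_expect n (G H : n.-tuple _ -> n.-tuple _ -> n.-tuple _ -> R) :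
  (forall x e y, 0 < joint_law pX pE f x e y -> G x e y <= H x e y) ->
  expect G <= expect H.
Proof.
move=> GH; apply: ler_sum => x _; apply: ler_sum => e _; apply: ler_sum => y _.
have [W0|W0] := ltP 0 (joint_law pX pE f x e y); first by rewrite ler_wpM2l ?GH // ltW.
suff -> : joint_law pX pE f x e y = 0 by rewrite !mul0r.
by apply/eqP; rewrite eq_le W0 joint_law_ge0.
Qed.

Lemma eq_expect n (G H : n.-tuple _ -> n.-tuple _ -> n.-tuple _ -> R) :
  (forall x e y, 0 < joint_law pX pE f x e y -> G x e y = H x e y) ->
  expect G = expect H.
Proof.
by move=> GH; apply/eqP; rewrite eq_le !le_expect // => x e y W; rewrite GH.
Qed.

Lemma expectD n (G H : n.-tuple _ -> n.-tuple _ -> n.-tuple _ -> R) :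
  expect (fun x e y => G x e y + H x e y) = expect G + expect H.
Proof.
rewrite /expect -big_split; apply: eq_bigr => x _ /=.
rewrite -big_split; apply: eq_bigr => e _ /=.
by rewrite -big_split; apply: eq_bigr => y _ /=; rewrite mulrDr.
Qed.

Lemma expectZ n k (G : n.-tuple _ -> n.-tuple _ -> n.-tuple _ -> R) :
  expect (fun x e y => k * G x e y) = k * expect G.
Proof.
rewrite /expect mulr_sumr; apply: eq_bigr => x _ /=.
rewrite mulr_sumr; apply: eq_bigr => e _ /=.
by rewrite mulr_sumr; apply: eq_bigr => y _ /=; rewrite mulrCA.
Qed.

Lemma sum_kernel (K : load Xmax -> energy Emax -> dist R (load Xmax))
    (g : load Xmax -> energy Emax -> R) :
  \sum_a \sum_b \sum_c pX a * pE b * K a b c * g a b =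
  \sum_a \sum_b pX a * pE b * g a b.
Proof.
apply: eq_bigr => a _; apply: eq_bigr => b _.
by rewrite -mulr_suml -mulr_sumr pmf_sum1 mulr1.
Qed.

Lemma sum_input (h : load Xmax -> R) :
  \sum_a \sum_b pX a * pE b * h a = \sum_a pX a * h a.
Proof.
by apply: eq_bigr => a _; rewrite -mulr_suml -mulr_sumr pmf_sum1 mulr1.
Qed.

Lemma sum_energy (g : energy Emax -> R) :
  \sum_a \sum_b pX a * pE b * g b = \sum_b pE b * g b.
Proof.
rewrite exchange_big; apply: eq_bigr => b _ /=.
by rewrite -mulr_suml -mulr_suml pmf_sum1 mul1r.
Qed.

Lemma expect_cst n k : expect (n := n) (fun _ _ _ => k) = k.
Proof.
elim: n => [|n IH]; first by rewrite expect0.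
rewrite expectS -[RHS]IH; apply: eq_expect => x e y _.
rewrite (sum_kernel (fun a b => f n (rcons x a) (rcons e b) (battery_history x e y n) y)
  (fun _ _ => k)) (sum_input (fun=> k)).
by rewrite -mulr_suml pmf_sum1 mul1r.
Qed.

(** Outputs are summed out from the last one backwards, each kernel of [f] contributing mass 1.
    Hence loads and energies are independent and i.i.d. under every policy. *)
Lemma sum_joint_law n (x : n.-tuple (load Xmax)) (e : n.-tuple (energy Emax)) :
  \sum_y joint_law pX pE f x e y =
  (\prod_(t < n) pX (tnth x t)) * \prod_(t < n) pE (tnth e t).
Proof.
elim: n x e => [|n IH] x e; first by rewrite sum_tuple0 /joint_law !big_ord0 mulr1.
have rconsE (T : Type) (z : n.+1.-tuple T) : exists (z' : n.-tuple T) d, z = rcons_tuple z' d.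
  case: z => z; case/lastP: z => [//|z d] zn.
  have zn' : size z == n by rewrite size_rcons eqSS in zn.
  by exists (Tuple zn'), d; exact: val_inj.
have [x' [a ->]] := rconsE _ x; have [e' [b ->]] := rconsE _ e.
have prodr (T : Type) (g : T -> R) (z : n.-tuple T) d :
    \prod_(t < n.+1) g (tnth (rcons_tuple z d) t) = \prod_(t < n) g (tnth z t) * g d.
  rewrite big_ord_recr /= tnth_rconsr; congr (_ * _).
  by apply: eq_bigr => t _; rewrite tnth_rconsl.
rewrite !prodr mulrACA -IH sum_rcons_tuple mulr_suml; apply: eq_bigr => y _.
under eq_bigr do rewrite joint_law_rcons.
by rewrite -mulr_sumr -mulr_sumr pmf_sum1 mulr1.
Qed.

End Expectation.

(** * Converse *)

Section Converse.
Variables (R : realType) (Xmax Emax : nat).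
Variables (pX : dist R (load Xmax)) (pE : dist R (energy Emax)).
Variable f : policy R Xmax Emax.
Implicit Types (a c : load Xmax) (b : energy Emax).
Local Notation Exp := (expect pX pE f).

Lemma expect_sum (I : finType) n
    (G : I -> n.-tuple (load Xmax) -> n.-tuple (energy Emax) -> n.-tuple (load Xmax) -> R) :
  Exp (fun x e y => \sum_i G i x e y) = \sum_i Exp (G i).
Proof.
rewrite /expect [RHS]exchange_big; apply: eq_bigr => x _ /=.
rewrite [RHS]exchange_big; apply: eq_bigr => e _ /=.
by rewrite [RHS]exchange_big; apply: eq_bigr => y _ /=; rewrite mulr_sumr.
Qed.

Lemma expect_gt0 n
    (G : n.-tuple (load Xmax) -> n.-tuple (energy Emax) -> n.-tuple (load Xmax) -> R)
    x e y :
  (forall x e y, 0 <= G x e y) -> 0 < joint_law pX pE f x e y -> 0 < G x e y ->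
  0 < Exp G.
Proof.
move=> G0 W Gxey.
have t0 x' e' y' : 0 <= joint_law pX pE f x' e' y' * G x' e' y'.
  by rewrite mulr_ge0 ?joint_law_ge0.
apply: (@sum_gt0 _ _ _ x) => [x'|]; first by apply: sumr_ge0 => e' _; exact: sumr_ge0.
apply: (@sum_gt0 _ _ _ e) => [e'|]; first exact: sumr_ge0.
by apply: (@sum_gt0 _ _ _ y) => //; rewrite mulr_gt0.
Qed.

Lemma expect_sum_fresh n (g : load Xmax -> energy Emax -> R) :
  Exp (n := n) (fun x e y => \sum_(t < n) g (tnth x t) (tnth e t)) =
  n%:R * \sum_a \sum_b pX a * pE b * g a b.
Proof.
elim: n => [|n IH]; first by rewrite expect0 big_ord0 mul0r.
set k := \sum_a _ in IH *.
rewrite -natr1 mulrDl mul1r -IH -[X in _ + X](expect_cst pX pE f n) -expectD expectS.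
apply: eq_expect => x e y _.
under eq_bigr do under eq_bigr do under eq_bigr do rewrite big_ord_recr /= !tnth_rconsr.
have E a b c : \sum_(t < n) g (tnth (rcons_tuple x a) (widen_ord (leqnSn n) t))
    (tnth (rcons_tuple e b) (widen_ord (leqnSn n) t)) =
    \sum_(t < n) g (tnth x t) (tnth e t).
  by apply: eq_bigr => t _; rewrite !tnth_rconsl.
under eq_bigr do under eq_bigr do under eq_bigr do rewrite E //.
set S := \sum_(t < n) _.
rewrite (sum_kernel pX pE (fun a b => f n (rcons x a) (rcons e b) (battery_history x e y n) y)
  (fun a b => S + g a b)).
under eq_bigr do under eq_bigr do rewrite mulrDr.
under eq_bigr do rewrite big_split /=.
rewrite big_split /=; congr (_ + _).
by rewrite (sum_input pX pE (fun=> S)) -mulr_suml pmf_sum1 mul1r.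
Qed.

Lemma battery_sum n (x y : n.-tuple (load Xmax)) (e : n.-tuple (energy Emax)) :
  (battery x e y n)%:~R = \sum_(t < n) ((tnth e t)%:R : R) -
    \sum_(t < n) ((tnth x t)%:R - (tnth y t)%:R).
Proof.
rewrite -sumrB.
under eq_bigr do rewrite !(tnth_nth ord0).
move: (tval x) (tval e) (tval y) => {x e y} x e y.
elim: n => [|n IH]; first by rewrite big_ord0.
by rewrite big_ord_recr /= -IH rmorphB rmorphD rmorphB /=; ring.
Qed.

(** The energy constraint at the last slot is exactly nonnegativity of the state that follows it. *)
Lemma battery_ge0 Phat n (x y : n.-tuple (load Xmax)) (e : n.-tuple (energy Emax)) :
  feasible pX pE Phat f -> 0 < joint_law pX pE f x e y -> 0 <= battery x e y n.
Proof.
case: n x y e => [//|n] x y e /(_ _ x e y) h /h /(_ ord_max) /= [_].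
rewrite le_min => /andP[+ _]; rewrite ler_int.
rewrite !(tnth_nth ord0) /=; lra.
Qed.

Lemma single_letter_converse Phat n : (0 < n)%N -> feasible pX pE Phat f ->
  exists p : load Xmax -> load Xmax -> R,
  [/\ forall a c, 0 <= p a c,
      forall a, \sum_c p a c = pX a,
      forall a c, 0 < p a c -> 0 <= (a%:R - c%:R : R) <= Phat,
      \sum_a \sum_c p a c * (a%:R - c%:R) <= mean_energy pE &
      n%:R * mutual_info p <= info_unknown pX pE f n].
Proof.
move=> n_gt0 feas.
have n0 : (n%:R : R) != 0 by rewrite pnatr_eq0 -lt0n.
have n0' : 0 < (n%:R : R)^-1 by rewrite invr_gt0 ltr0n.
pose cnt a c (x : n.-tuple (load Xmax)) (e : n.-tuple (energy Emax))
    (y : n.-tuple (load Xmax)) : R :=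
  \sum_(t < n) ((tnth x t == a) && (tnth y t == c))%:R.
have cnt0 a c x e y : 0 <= cnt a c x e y by apply: sumr_ge0.
(* The time-averaged law of a slot, written as an expected empirical frequency. *)
pose p a c := n%:R^-1 * Exp (cnt a c).
have p0 a c : 0 <= p a c.
  rewrite mulr_ge0 ?(ltW n0') //; apply: sumr_ge0 => x _; apply: sumr_ge0 => e _.
  by apply: sumr_ge0 => y _; rewrite mulr_ge0 ?joint_law_ge0.
(* Turns averages under [p] into expectations over trajectories. It is applied to indicators of an
   input, to the drawn energy and to the log-ratio in the mutual information. *)
have pE' (h : load Xmax -> load Xmax -> R) :
    n%:R * (\sum_a \sum_c p a c * h a c) =
    Exp (fun x e y => \sum_(t < n) h (tnth x t) (tnth y t)).
  transitivity (\sum_a \sum_c Exp (fun x e y => h a c * cnt a c x e y)).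
    rewrite mulr_sumr; apply: eq_bigr => a _; rewrite mulr_sumr; apply: eq_bigr => c _.
    by rewrite expectZ /p; field.
  under eq_bigr do rewrite -expect_sum; rewrite -expect_sum.
  apply: eq_expect => x e y _.
  under eq_bigr do under eq_bigr do rewrite mulr_sumr.
  under eq_bigr do rewrite exchange_big /=; rewrite exchange_big /=.
  apply: eq_bigr => t _; rewrite (bigD1 (tnth x t)) //= (bigD1 (tnth y t)) //=.
  rewrite !eqxx mulr1 big1 ?addr0; last first.
    by move=> c; rewrite eq_sym => /negPf ->; rewrite mulr0.
  rewrite big1 ?addr0 // => a; rewrite eq_sym => /negPf an.
  by apply: big1 => c _; rewrite an mulr0.
have pXp a : \sum_c p a c = pX a.
  apply: (mulfI n0).
  have := pE' (fun a' c => (a' == a)%:R).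
  rewrite (expect_sum_fresh n (fun a' b => (a' == a)%:R)) sum_input.
  have ind (F : load Xmax -> R) : \sum_a' F a' * (a' == a)%:R = F a.
    rewrite (bigD1 a) //= eqxx mulr1 big1 ?addr0 // => a' /negPf ->; exact: mulr0.
  by rewrite ind; under eq_bigr do rewrite -mulr_suml; rewrite ind.
have pgt0 (x y : n.-tuple (load Xmax)) (e : n.-tuple (energy Emax)) :
    0 < joint_law pX pE f x e y -> forall t, 0 < p (tnth x t) (tnth y t).
  move=> W t; rewrite /p mulr_gt0 //; apply: (expect_gt0 _ W) => //.
  by apply: (@sum_gt0 _ _ _ t) => //=; rewrite !eqxx.
exists p; split => //.
- move=> a c pac; apply: contraTT pac => nac; rewrite -leNgt.
  suff -> : p a c = 0 by [].
  rewrite /p -[RHS](mulr0 n%:R^-1) -[X in _ = _ * X](expect_cst pX pE f n); congr (_ * _).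
  apply: eq_expect => x e y W; apply: big1 => t _.
  have [/eqP xa|//] := boolP (tnth x t == a); have [/eqP yc|//] := boolP (tnth y t == c).
  have /= [] := feas n x e y W t.
  rewrite xa yc rmorphB /= le_min => h1 /andP[_ h2].
  by rewrite h1 h2 in nac.
- rewrite -(ler_pM2l (_ : 0 < n%:R)) ?ltr0n // pE'.
  have -> : n%:R * mean_energy pE =
      Exp (n := n) (fun x e y => \sum_(t < n) (tnth e t)%:R).
    rewrite (expect_sum_fresh n (fun a b => b%:R)) sum_energy; congr (_ * _).
    by apply: eq_bigr => b _; rewrite mulrC.
  (* Harvested minus drawn energy is the final battery state, nonnegative on trajectories of
     positive probability. *)
  apply: le_expect => x e y W; rewrite -subr_ge0 -battery_sum ler0z.
  exact: battery_ge0 feas W.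
(* The reverse channel of [p]. A column of zero mass is 0 by the convention for division by 0, so
   columns sum to 1 or 0. *)
- pose v a c := p a c / \sum_a' p a' c.
  have v0 a c : 0 <= v a c by rewrite divr_ge0 // sumr_ge0.
  pose P (x y : n.-tuple (load Xmax)) := \sum_e joint_law pX pE f x e y.
  have P0 x y : 0 <= P x y by apply: sumr_ge0 => e _; exact: joint_law_ge0.
  have PX x : \sum_y P x y = \prod_(t < n) pX (tnth x t).
    rewrite /P exchange_big /=; under eq_bigr do rewrite sum_joint_law.
    rewrite -mulr_sumr (sum_tuple_prod n (fun _ => pE)).
    by rewrite [X in _ * X]big1 ?mulr1 // => t _; exact: pmf_sum1.
  have Pgt0 x y : 0 < P x y -> exists2 e, 0 < joint_law pX pE f x e y &
      forall t, 0 < p (tnth x t) (tnth y t).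
    move=> /sum_gt0P [e|e W]; first exact: joint_law_ge0.
    by exists e => //; exact: pgt0 W.
  have vgt0 a c : 0 < p a c -> 0 < v a c.
    by move=> h; rewrite divr_gt0 //; apply: (sum_gt0 (F := fun a => p a c)) h.
  apply: le_trans (mutual_info_ge (p := P)
    (V := fun x y => \prod_(t < n) v (tnth x t) (tnth y t)) _ _ _ _) => //.
  (* The inputs have a product law and the reverse channel is memoryless, so the logarithm splits
     into a sum over slots, to which [pE'] applies. *)
  + under eq_bigr do under eq_bigr do rewrite PX.
    rewrite /mutual_info pE'.
    rewrite /expect le_eqVlt; apply/orP; left; apply/eqP; apply: eq_bigr => x _.
    rewrite exchange_big; apply: eq_bigr => y _ /=; rewrite -mulr_suml.
    have [Pxy|Pxy] := ltP 0 (P x y); last first.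
      have P_0 : P x y = 0 by apply/eqP; rewrite eq_le Pxy P0.
      by rewrite -/(P x y) P_0 !mul0r.
    congr (_ * _); have [e W pt] := Pgt0 _ _ Pxy.
    have pXgt0 a c : 0 < p a c -> 0 < pX a.
      by move=> h; rewrite -pXp; apply: sum_gt0 h.
    rewrite ln_div ?posrE; last 2 first.
      by apply: prodr_gt0 => t _; exact: vgt0.
      by apply: prodr_gt0 => t _; exact: pXgt0 (pt t).
    rewrite !ln_prod => [|t|t]; [|exact: pXgt0 (pt t)|exact: vgt0].
    rewrite -sumrB; apply: eq_bigr => t _; rewrite -ln_div ?posrE; last 2 first.
      exact: vgt0.
      exact: pXgt0 (pt t).
    by rewrite pXp /v invfM mulrA mulrAC.
  + by move=> x y; exact: prodr_ge0.
  + move=> y; under eq_bigr do under eq_bigr do rewrite (tnth_nth ord0 y).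
    have /= -> := sum_tuple_prod n (fun t a => v a (nth ord0 y t)).
    apply: prodr_ile1 => t _; rewrite sumr_ge0 //= /v -mulr_suml.
    set S := \sum_i _; have [->|S0] := eqVneq S 0; first by rewrite mul0r.
    by rewrite divff.
  + move=> x y /Pgt0 [_ _ pt]; apply: prodr_gt0 => t _; exact: vgt0.
Qed.

End Converse.

(** * Achievability *)

Section ExponentialMoment.
Variable R : realType.

(** First [exp (- u) <= 1 / (1 + u)]; then [(1 + u) * (1 - u + 2 * u ^+ 2) = 1 + u ^+ 2 * (1 + 2 *
    u)], which is at least 1 in this range. *)
Lemma expRN_quadratic (u : R) : `|u| <= 2^-1 -> expR (- u) <= 1 - u + 2 * u ^+ 2.
Proof.
rewrite ler_norml => /andP[u1 u2].
rewrite expRN; apply: (@le_trans _ _ (1 + u)^-1).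
  by rewrite lef_pV2 ?posrE ?expR_gt0 ?expR_ge1Dx //; lra.
rewrite -[leLHS]mul1r ler_pdivrMr; last by lra.
have : 0 <= u ^+ 2 * (1 + 2 * u) by rewrite mulr_ge0 ?sqr_ge0 //; lra.
nra.
Qed.

(** The moment is 1 at [s = 0] and has slope minus the mean of [Z] there. The bound covers all [s]
    up to [s0] so that two variables can share one exponent. *)
Lemma exp_moment_lt1 (T : finType) (w Z : T -> R) :
  (forall i, 0 <= w i) -> \sum_i w i = 1 -> 0 < \sum_i w i * Z i ->
  exists2 s0, 0 < s0 & forall s, 0 < s <= s0 -> \sum_i w i * expR (- (s * Z i)) < 1.
Proof.
move=> w0 w1; set m := \sum_i _ => m0.
pose M := 1 + \sum_i `|Z i|.
have M1 : 1 <= M by rewrite lerDl sumr_ge0.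
have ZM i : `|Z i| <= M.
  rewrite /M (bigD1 i) //= addrCA lerDl addr_ge0 ?sumr_ge0 //.
have M0 : 0 < M by lra.
(* The first bound gives [s * M <= 1/2], the range of the quadratic estimate. The second makes the
   quadratic term [2 * (s * M) ^+ 2] at most [s * m / 2]. *)
exists (Num.min (2^-1 / M) (m / (4 * M ^+ 2))).
  by rewrite lt_min !divr_gt0 ?mulr_gt0 ?exprn_gt0.
move=> s /andP[s0]; rewrite le_min => /andP[].
rewrite !ler_pdivlMr ?mulr_gt0 ?exprn_gt0 // => s1 s2.
have bound i : w i * expR (- (s * Z i)) <= w i - s * (w i * Z i) + w i * (2 * (s * M) ^+ 2).
  have sZ : `|s * Z i| <= s * M by rewrite normrM gtr0_norm // ler_pM2l.
  have h : expR (- (s * Z i)) <= 1 - s * Z i + 2 * (s * M) ^+ 2.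
    apply: le_trans (expRN_quadratic (le_trans sZ s1)) _.
    by rewrite lerD2l ler_pM2l // -real_normK ?num_real // lerXn2r ?nnegrE // mulr_ge0 // ltW.
  by have := ler_wpM2l (w0 i) h; lra.
apply: (@le_lt_trans _ _ (1 - s * m + 2 * (s * M) ^+ 2)).
  apply: le_trans (ler_sum _ (fun i _ => bound i)) _.
  by rewrite big_split /= sumrB -mulr_sumr -mulr_suml w1 mul1r.
have := ler_wpM2l (ltW s0) s2; have := mulr_gt0 s0 m0.
nra.
Qed.

End ExponentialMoment.

(** * The threshold policy: feasibility, leakage and battery drift *)

Section StorePolicy.
Variables (R : realType) (Xmax Emax : nat).
Variables (pX : dist R (load Xmax)) (pE : dist R (energy Emax)).
Implicit Types (a c : load Xmax) (b : energy Emax).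

Lemma dirac_ge0 a c : 0 <= (c == a)%:R :> R. Proof. by []. Qed.

Lemma dirac_sum1 a : \sum_c (c == a)%:R = 1 :> R.
Proof. by rewrite (bigD1 a) //= eqxx big1 ?addr0 // => c /negPf ->. Qed.

Definition dirac_dist a : dist R (load Xmax) := Dist (dirac_ge0 a) (dirac_sum1 a).

Variable K : load Xmax -> dist R (load Xmax).

(** With [Xmax] units stored every draw of [K] is covered. Below that level nothing is drawn, so the
    battery cannot fall. *)
Definition store_kernel (B : int) a : dist R (load Xmax) :=
  if Xmax%:Z <= B then K a else dirac_dist a.

Definition store_policy : policy R Xmax Emax :=
  fun t xs es bs ys => store_kernel (last 0 bs) (last ord0 xs).

Local Notation W := (joint_law pX pE store_policy).
Local Notation Exp := (expect pX pE store_policy).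

Lemma last_battery_history (x : seq (load Xmax)) (e : seq (energy Emax)) y t :
  last 0 (battery_history x e y t) = battery x e y t.
Proof. by rewrite /battery_history -addn1 iotaD map_cat last_cat. Qed.

Lemma store_policy_rcons n xs a es (x : seq (load Xmax)) (e : seq (energy Emax)) y ys :
  store_policy n (rcons xs a) es (battery_history x e y n) ys =
  store_kernel (battery x e y n) a.
Proof. by rewrite /store_policy last_rcons last_battery_history. Qed.

Lemma joint_law_gt0 n (x y : n.-tuple (load Xmax)) (e : n.-tuple (energy Emax)) :
  0 < W x e y -> forall t, 0 < pX (tnth x t) /\
    0 < store_kernel (battery x e y t) (tnth x t) (tnth y t).
Proof.
move=> W0 t; have := W0; rewrite /joint_law (bigD1 t) //= => /lt0r_neq0.
rewrite !mulf_eq0 !negb_or -!andbA => /and4P[h1 _ h2 _].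
rewrite !lt0r !pmf_ge0 h1 !andbT; split=> //; move: h2.
rewrite /store_policy last_battery_history.
rewrite (take_nth ord0) ?size_tuple // last_rcons.
by rewrite !(tnth_nth ord0).
Qed.

Hypothesis Kdiag : forall a, 0 < pX a -> 0 < K a a.

Lemma store_policy_feasible Phat : 0 <= Phat ->
  (forall a c, 0 < pX a -> 0 < K a c -> 0 <= (a%:R - c%:R : R) <= Phat) ->
  feasible pX pE Phat store_policy.
Proof.
move=> Phat0 supp n x e y W0.
have step (t : 'I_n) : 0 <= battery x e y t ->
    [/\ 0 <= (tnth x t)%:R - (tnth y t)%:R :> R,
        (tnth x t)%:R - (tnth y t)%:R <= Phat &
        (tnth x t)%:Z - (tnth y t)%:Z <= battery x e y t + (tnth e t)%:Z].
  have [p0] := joint_law_gt0 W0 t; rewrite /store_kernel; case: ifP => [hB k0|_ k0] B0.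
    have /andP[h1 h2] := supp _ _ p0 k0; split => //.
    apply: (@le_trans _ _ Xmax%:Z); last by apply: le_trans hB _; rewrite lerDl.
    apply: (@le_trans _ _ (tnth x t)%:Z); first by rewrite gerBl.
    by rewrite lez_nat -ltnS ltn_ord.
  move: k0 => /=; case: eqP => [->|_]; last by rewrite ltxx.
  by move=> _; rewrite !subrr; split => //; rewrite addr_ge0.
(* A nonnegative battery makes the slot satisfy its constraints, and these make the next state
   nonnegative. *)
have B0 t : (t <= n)%N -> 0 <= battery x e y t.
  elim: t => [//|t IH] tn; have [_ _] := step (Ordinal tn) (IH (ltnW tn)).
  by rewrite !(tnth_nth ord0) /=; lra.
move=> t /=; have [h1 h2 h3] := step t (B0 t (ltnW (ltn_ord t))).
by rewrite le_min ler_int h3 rmorphB /= h1 h2.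
Qed.

Definition output c : R := \sum_a pX a * K a c.

(* Expected log-likelihood ratio of one slot, against the output law of K, when the
   battery is full enough ([rate_cost]) and when it is not ([store_cost]). *)
Definition rate_cost : R := \sum_a \sum_c pX a * K a c * ln (K a c / output c).

Definition store_cost : R := \sum_a pX a * ln (1 / output a).

Lemma output_ge0 c : 0 <= output c.
Proof. by apply: sumr_ge0 => a _; rewrite mulr_ge0 ?pmf_ge0. Qed.

Lemma output_sum1 : \sum_c output c = 1.
Proof.
rewrite exchange_big /= -[RHS](pmf_sum1 pX); apply: eq_bigr => a _.
by rewrite -mulr_sumr pmf_sum1 mulr1.
Qed.

(** The positive diagonal of [K] makes the output law charge the symbols emitted at low battery, so
    the likelihood ratios have positive denominators in both modes. *)
Lemma output_gt0 B a c : 0 < pX a -> 0 < store_kernel B a c -> 0 < output c.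
Proof.
have t0 a' : 0 <= pX a' * K a' c by rewrite mulr_ge0 ?pmf_ge0.
move=> p0; rewrite /store_kernel; case: ifP => _ => [k0|/=].
  by apply: (sum_gt0 (i := a)) => //; rewrite mulr_gt0.
case: eqP => [->|_]; last by rewrite ltxx.
move=> _; apply: (sum_gt0 (i := a)) => [a'|]; last by rewrite mulr_gt0 // Kdiag.
by rewrite mulr_ge0 ?pmf_ge0.
Qed.

Definition low_battery n : R :=
  Exp (n := n) (fun x e y => (battery x e y n < Xmax%:Z)%R%:R).

(** Against the i.i.d. law with marginal [output], a slot costs [rate_cost] on average, or
    [store_cost] at low battery; only the expected number of low-battery slots enters the
    correction. *)
Lemma info_known_store_le n :
  info_known pX pE store_policy n <=
  n%:R * rate_cost + (store_cost - rate_cost) * \sum_(t < n) low_battery t.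
Proof.
pose D n (x y : n.-tuple (load Xmax)) (e : n.-tuple (energy Emax)) :=
  \prod_(t < n) (pX (tnth x t) * pE (tnth e t) * output (tnth y t)).
(* [D] is the memoryless law with independent input, energy and output. The only inequality is the
   passage to this comparison law; the rest is an exact computation by induction on [n]. *)
apply: (@le_trans _ _ (Exp (n := n) (fun x e y => ln (W x e y / D n x y e)))).
  apply: le_trans (cond_mutual_info_le (Q := fun y : n.-tuple _ => \prod_(t < n) output (tnth y t))
    _ _ _ _) _.
  - by move=> *; exact: joint_law_ge0.
  - by move=> y; apply: prodr_ge0 => t _; exact: output_ge0.
  - rewrite (sum_tuple_prod n (fun _ => output)).
    by rewrite big1 // => t _; exact: output_sum1.
  - move=> x y e W0; apply: prodr_gt0 => t _; have [h1 h2] := joint_law_gt0 W0 t.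
    exact: output_gt0 h1 h2.
  - rewrite exchange_big /expect; apply: ler_sum => x _; apply: ler_sum => e _.
    apply: ler_sum => y _; rewrite sum_joint_law.
    by rewrite /D !big_split.
rewrite le_eqVlt; apply/orP; left; apply/eqP; elim: n => [|n IH].
  by rewrite expect0 /joint_law /D !big_ord0 divr1 ln1 mul0r mulr0 addr0.
rewrite big_ord_recr /= mulrDr -natr1 mulrDl mul1r addrACA -IH /low_battery.
rewrite -expectZ -[X in _ = _ + (X + _)](expect_cst pX pE store_policy n) -!expectD.
rewrite expectS; apply: eq_expect => x e y W0.
set L := ln _; set B := battery x e y n.
(* Both laws factor over the last slot, whose input and energy weights cancel in the ratio, leaving
   one logarithm to add to the past [L]. *)
transitivity (\sum_a \sum_b \sum_c
    pX a * pE b * store_kernel B a c * (L + ln (store_kernel B a c / output c))).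
  apply: eq_bigr => a _; apply: eq_bigr => b _; apply: eq_bigr => c _.
  rewrite store_policy_rcons -/B.
  have [w0|w0] := eqVneq (pX a * pE b * store_kernel B a c) 0; first by rewrite w0 !mul0r.
  move: (w0); rewrite !mulf_eq0 !negb_or => /andP[/andP[a0 b0] k0].
  have {}a0 : 0 < pX a by rewrite lt0r a0 pmf_ge0.
  have {}b0 : 0 < pE b by rewrite lt0r b0 pmf_ge0.
  have {}k0 : 0 < store_kernel B a c by rewrite lt0r k0 pmf_ge0.
  have o0 := output_gt0 a0 k0.
  have D0 : 0 < D n x y e.
    apply: prodr_gt0 => t _; have [h1 h2] := joint_law_gt0 W0 t.
    rewrite !mulr_gt0 //; last exact: output_gt0 h1 h2.
    have := W0; rewrite /joint_law (bigD1 t) //= => /lt0r_neq0.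
    by rewrite !mulf_eq0 !negb_or => /andP[/andP[/andP[_ h] _] _]; rewrite lt0r h pmf_ge0.
  congr (_ * _); rewrite joint_law_rcons store_policy_rcons -/B.
  have -> : D n.+1 (rcons_tuple x a) (rcons_tuple y c) (rcons_tuple e b) =
      D n x y e * (pX a * pE b * output c).
    rewrite /D big_ord_recr /= !tnth_rconsr; congr (_ * _).
    by apply: eq_bigr => t _; rewrite !tnth_rconsl.
  rewrite /L -lnM ?posrE ?divr_gt0 //; congr ln.
  by field; rewrite !gt_eqF.
transitivity (L + \sum_a \sum_c pX a * store_kernel B a c *
    ln (store_kernel B a c / output c)).
  under eq_bigr do under eq_bigr do under eq_bigr do rewrite mulrDr.
  under eq_bigr do under eq_bigr do rewrite big_split.
  under eq_bigr do rewrite big_split.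
  rewrite big_split /=; congr (_ + _).
    rewrite (sum_kernel pX pE (fun a _ => store_kernel B a) (fun _ _ => L)).
    by rewrite (sum_input pX pE (fun=> L)) -mulr_suml pmf_sum1 mul1r.
  apply: eq_bigr => a _; rewrite exchange_big; apply: eq_bigr => c _ /=.
  by rewrite -!mulr_suml -mulr_sumr pmf_sum1 mulr1.
congr (_ + _); rewrite /store_kernel ltNge; case: (Xmax%:Z <= B) => /=.
  by rewrite mulr0 addr0.
rewrite mulr1 addrC subrK; apply: eq_bigr => a _.
rewrite (bigD1 a) //= eqxx mulr1 big1 ?addr0 // => c /negPf ->.
by rewrite mulr0 mul0r.
Qed.

Hypothesis mean_gt0 : 0 < mean_energy pE.
Hypothesis drift : \sum_a \sum_c pX a * K a c * (a%:R - c%:R) < mean_energy pE.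

Lemma low_battery_summable : exists C, forall n, \sum_(t < n) low_battery t <= C.
Proof.
(* The law of a slot in which [K] is used, and the resulting battery increment. *)
pose w (i : load Xmax * energy Emax * load Xmax) := pX i.1.1 * pE i.1.2 * K i.1.1 i.2.
pose Z (i : load Xmax * energy Emax * load Xmax) : R := i.1.2%:R - (i.1.1%:R - i.2%:R).
have sumT (F : load Xmax * energy Emax * load Xmax -> R) :
    \sum_i F i = \sum_a \sum_b \sum_c F (a, b, c).
  rewrite (eq_bigr (fun i => F (i.1.1, i.1.2, i.2))); last by move=> [[]].
  rewrite -(pair_bigA _ (fun i c => F (i.1, i.2, c))) /=.
  by rewrite -(pair_bigA _ (fun a b => \sum_c F (a, b, c))).
have w1 : \sum_i w i = 1.
  rewrite sumT /w /=; under eq_bigr do under eq_bigr do rewrite -mulr_sumr pmf_sum1 mulr1.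
  under eq_bigr do rewrite -mulr_sumr pmf_sum1 mulr1.
  exact: pmf_sum1.
have w0 i : 0 <= w i by rewrite /w !mulr_ge0 ?pmf_ge0.
have [|s1 s1_gt0 h1] := exp_moment_lt1 (w := w) (Z := Z) w0 w1.
  rewrite sumT /w /Z /=.
  under eq_bigr do under eq_bigr do under eq_bigr do rewrite mulrBr.
  under eq_bigr do under eq_bigr do rewrite sumrB.
  under eq_bigr do rewrite sumrB.
  rewrite sumrB (sum_kernel pX pE (fun a _ => K a) (fun _ b => b%:R)) sum_energy.
  rewrite subr_gt0; apply: le_lt_trans (lt_le_trans drift _).
    rewrite le_eqVlt; apply/orP; left; apply/eqP.
    apply: eq_bigr => a _; rewrite exchange_big; apply: eq_bigr => c _ /=.
    by rewrite -!mulr_suml -mulr_sumr pmf_sum1 mulr1.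
  by apply: ler_sum => b _; rewrite mulrC.
have [|s2 s2_gt0 h2] := exp_moment_lt1 (w := pE) (Z := fun b => b%:R)
    (pmf_ge0 pE) (pmf_sum1 pE).
  by under eq_bigr do rewrite mulrC.
(* One exponent for both modes: with [K] the drift is positive by [drift], and when storing it is
   the mean energy. *)
pose s := Num.min s1 s2.
have s_gt0 : 0 < s by rewrite lt_min s1_gt0.
pose M1 := \sum_i w i * expR (- (s * Z i)).
pose M2 := \sum_b pE b * expR (- (s * b%:R)).
have M1_lt1 : M1 < 1 by apply: h1; rewrite s_gt0 ge_min lexx.
have M2_lt1 : M2 < 1 by apply: h2; rewrite s_gt0 ge_min lexx orbT.
pose r := Num.max M1 M2.
have r_lt1 : r < 1 by rewrite gt_max M1_lt1.
have r_ge0 : 0 <= r.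
  rewrite le_max; apply/orP; left; apply: sumr_ge0 => i _.
  by rewrite mulr_ge0 ?expR_ge0.
(* Both branches of [store_kernel] contract E[exp (- s B)] by the factor r. *)
have decay n : Exp (n := n) (fun x e y => expR (- (s * (battery x e y n)%:~R))) <= r ^+ n.
  elim: n => [|n IH]; first by rewrite expect0 /= mulr0 oppr0 expR0 expr0.
  rewrite expectS exprS; apply: le_trans (ler_wpM2l r_ge0 IH).
  rewrite -expectZ; apply: le_expect => x e y W0.
  set B := battery x e y n.
  under eq_bigr do under eq_bigr do under eq_bigr do
    rewrite store_policy_rcons batteryS -/B.
  have split a b c : expR (- (s * (B + b%:Z - (a%:Z - c%:Z))%:~R)) =
      expR (- (s * Z (a, b, c))) * expR (- (s * B%:~R)).
    by rewrite -expRD /Z /= rmorphB rmorphD rmorphB /=; congr expR; ring.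
  under eq_bigr do under eq_bigr do under eq_bigr do rewrite split mulrA.
  under eq_bigr do under eq_bigr do rewrite -mulr_suml.
  under eq_bigr do rewrite -mulr_suml.
  rewrite -mulr_suml ler_wpM2r ?expR_ge0 // le_max /store_kernel.
  case: (Xmax%:Z <= B); first by rewrite /M1 sumT lexx.
  apply/orP; right; rewrite /M2 -(sum_energy pX pE) le_eqVlt; apply/orP; left; apply/eqP.
  apply: eq_bigr => a _; apply: eq_bigr => b _ /=.
  rewrite (bigD1 a) //= eqxx mulr1 big1 ?addr0 => [|c /negPf ->]; last by rewrite mulr0 mul0r.
  by rewrite /Z /= subrr subr0.
(* Markov's inequality: the indicator of [B < Xmax] is at most [exp (s * (Xmax - B))]. *)
have markov n : low_battery n <= expR (s * Xmax%:R) * r ^+ n.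
  apply: le_trans (ler_wpM2l (expR_ge0 _) (decay n)).
  rewrite -expectZ; apply: le_expect => x e y _.
  rewrite -expRD; case: ltP => [hB|_]; last exact: expR_ge0.
  rewrite -[leLHS]expR0 ler_expR -mulrBr mulr_ge0 ?(ltW s_gt0) // subr_ge0.
  by rewrite -[leRHS]/((Xmax%:Z)%:~R) ler_int ltW.
exists (expR (s * Xmax%:R) / (1 - r)) => n.
apply: le_trans (ler_sum _ (fun t _ => markov (nat_of_ord t))) _.
rewrite -mulr_sumr ler_pM2l ?expR_gt0 //.
have r1 : 0 < 1 - r by rewrite subr_gt0.
rewrite -[leRHS]mul1r ler_pdivlMr // mulrC.
have -> : (1 - r) * (\sum_(i < n) r ^+ i) = 1 - r ^+ n by rewrite -opprB mulNr -subrX1 opprB.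
by rewrite gerBl exprn_ge0.
Qed.

End StorePolicy.

(** * Limits superior in the extended reals *)

Section LimitSuperior.
Variable R : realType.
Implicit Types u v : nat -> \bar R.
Local Open Scope ereal_scope.

Lemma le_limn_esup u v : (forall n, u n <= v n) -> limn_esup u <= limn_esup v.
Proof.
move=> uv; apply: le_ereal_inf_tmp => _ [V oV <-].
apply: (@le_trans _ _ (ereal_sup (u @` V))).
  by apply: ereal_inf_lbound; exists V.
by apply: ge_ereal_sup => _ [n Vn <-]; apply: le_trans (uv n) _; apply: ereal_sup_ubound; exists n.
Qed.

Lemma limn_esup_ge_near u (M : \bar R) N : (forall n, (N <= n)%N -> u n <= M) ->
  limn_esup u <= M.
Proof.
move=> uM; apply: (@le_trans _ _ (ereal_sup (u @` [set n | (N <= n)%N]))).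
  by apply: ereal_inf_lbound; exists [set n | (N <= n)%N] => //; exists N.
by apply: ge_ereal_sup => _ [n Nn <-]; exact: uM.
Qed.

(** One good blocklength is all the converse needs; it must be positive, since the converse averages
    over its slots. *)
Lemma limn_esup_lt_exists u (M : \bar R) : limn_esup u < M ->
  exists2 n, (0 < n)%N & u n < M.
Proof.
move=> /ereal_inf_lt[_ [V [N _ NV] <-]] VM; exists N.+1 => //.
apply: le_lt_trans VM; apply: ereal_sup_ubound; exists N.+1 => //.
by apply: NV => /=.
Qed.

End LimitSuperior.

(** * Mixing a single-letter law with the identity, and comparing the two infima *)

Section Achievability.
Variables (R : realType) (Xmax Emax : nat).
Variables (pX : dist R (load Xmax)) (pE : dist R (energy Emax)).
Implicit Types (a c : load Xmax) (b : energy Emax).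

Definition input_entropy : R := \sum_a pX a * ln (pX a)^-1.

Section Mixture.
Variable p : load Xmax -> load Xmax -> R.
Hypothesis p_ge0 : forall a c, 0 <= p a c.
Hypothesis p_marginal : forall a, \sum_c p a c = pX a.
Variable d : R.
Hypothesis d01 : 0 < d < 1.

Let d0 : 0 < d. Proof. by case/andP: d01. Qed.
Let d1 : 0 < 1 - d. Proof. by rewrite subr_gt0; case/andP: d01. Qed.

Lemma joint_le_marginal a c : p a c <= pX a.
Proof. by rewrite -p_marginal (bigD1 c) //= lerDl sumr_ge0. Qed.

(** Where [pX a = 0] there is no conditional law of [p]; the identity row keeps this a kernel. *)
Definition mix_pmf a c : R :=
  if 0 < pX a then (1 - d) * (p a c / pX a) + d * (c == a)%:R else (c == a)%:R.

Lemma mix_pmf_ge0 a c : 0 <= mix_pmf a c.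
Proof.
rewrite /mix_pmf; case: ifP => // h.
by apply: addr_ge0; rewrite mulr_ge0 ?divr_ge0 ?pmf_ge0 ?(ltW d0) ?(ltW d1).
Qed.

Lemma mix_pmf_sum1 a : \sum_c mix_pmf a c = 1.
Proof.
rewrite /mix_pmf; case: (boolP (0 < pX a)) => h; last exact: dirac_sum1.
rewrite big_split /= -!mulr_sumr dirac_sum1 -mulr_suml p_marginal divff ?gt_eqF //; ring.
Qed.

Definition mix_kernel a : dist R (load Xmax) := Dist (mix_pmf_ge0 a) (mix_pmf_sum1 a).

Lemma mix_kernelE a c :
  pX a * mix_kernel a c = (1 - d) * p a c + d * (pX a * (c == a)%:R).
Proof.
rewrite /= /mix_pmf; case: (ltP 0 (pX a)) => h; first by field; rewrite gt_eqF.
have pa : pX a = 0 by apply/eqP; rewrite eq_le h pmf_ge0.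
have -> : p a c = 0 by apply/eqP; rewrite eq_le p_ge0 -pa joint_le_marginal.
by rewrite pa; ring.
Qed.

Lemma mix_kernel_diag a : 0 < pX a -> 0 < mix_kernel a a.
Proof.
move=> h; rewrite -(pmulr_rgt0 _ h) mix_kernelE eqxx mulr1.
by rewrite ltr_wpDl ?mulr_ge0 ?mulr_gt0 ?(ltW d1).
Qed.

Lemma mix_kernel_sum (h : load Xmax -> load Xmax -> R) :
  \sum_a \sum_c pX a * mix_kernel a c * h a c =
  (1 - d) * (\sum_a \sum_c p a c * h a c) + d * \sum_a pX a * h a a.
Proof.
rewrite !mulr_sumr -big_split; apply: eq_bigr => a _ /=.
under eq_bigr do rewrite mix_kernelE mulrDl; rewrite big_split /=; congr (_ + _).
  by rewrite mulr_sumr; apply: eq_bigr => c _; rewrite mulrA.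
rewrite (bigD1 a) //= eqxx mulr1 big1 ?addr0 ?mulrA // => c /negPf ->.
by rewrite !mulr0 mul0r.
Qed.

Lemma output_mix c : output pX mix_kernel c = (1 - d) * (\sum_a p a c) + d * pX c.
Proof.
rewrite /output; under eq_bigr do rewrite mix_kernelE.
rewrite big_split /= -!mulr_sumr; congr (_ + _ * _).
rewrite (bigD1 c) //= eqxx mulr1 big1 ?addr0 // => a; rewrite eq_sym => /negPf ->.
exact: mulr0.
Qed.

(** Convexity of the information in the channel, at fixed input law: [log_sum] is applied to each
    pair. The identity channel contributes the input entropy. *)
Lemma rate_cost_mix_le :
  rate_cost pX mix_kernel <= (1 - d) * mutual_info p + d * input_entropy.
Proof.
have pY0 c : 0 <= \sum_a p a c by apply: sumr_ge0.
have term a c : pX a * mix_kernel a c * ln (mix_kernel a c / output pX mix_kernel c) <=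
    (1 - d) * (p a c * ln (p a c / (pX a * \sum_a' p a' c))) +
    d * (pX a * (c == a)%:R * ln (pX a)^-1).
  have [pa|pa] := eqVneq (pX a) 0.
    have -> : p a c = 0 by apply/eqP; rewrite eq_le p_ge0 -pa joint_le_marginal.
    by rewrite pa !mul0r !mulr0 addr0.
  have {}pa : 0 < pX a by rewrite lt0r pa pmf_ge0.
  (* Multiplying by [pX a] makes numerator and denominator mixtures with the same weights, the shape
     of [log_sum]; the weights then cancel inside each logarithm. *)
  have -> : mix_kernel a c / output pX mix_kernel c =
      (pX a * mix_kernel a c) / (pX a * output pX mix_kernel c).
    by rewrite -mulf_div divff ?gt_eqF // mul1r.
  rewrite mix_kernelE output_mix mulrDr.
  have pY_gt0 : 0 < p a c -> 0 < \sum_a' p a' c.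
    by move=> h; apply: (sum_gt0 (F := fun a => p a c)) h.
  apply: le_trans (log_sum _ _ _ _ _ _) _.
  - by rewrite mulr_ge0 // ltW.
  - by rewrite !mulr_ge0 // ltW.
  - by rewrite !mulr_ge0 // ltW.
  - by rewrite !mulr_ge0 ?pmf_ge0 // ltW.
  - by rewrite pmulr_rgt0 // => /pY_gt0 h; rewrite !mulr_gt0.
  - case: eqP => [->|_]; last by rewrite !mulr0 ltxx.
    by move=> _; rewrite !mulr_gt0.
  rewrite -!mulrA; apply: lerD.
    have -> : (1 - d) * (p a c * ln ((1 - d) * (p a c * (pX a * ((1 - d) * \sum_a' p a' c))^-1)))
      = (1 - d) * (p a c * ln (p a c * (pX a * \sum_a' p a' c)^-1)); last by [].
    have [h|h] := ltP 0 (p a c).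
      by congr (_ * (_ * ln _)); have := pY_gt0 h => h'; field; rewrite !gt_eqF.
    have -> : p a c = 0 by apply/eqP; rewrite eq_le h p_ge0.
    by rewrite !mul0r.
  case: eqP => [->|_]; last by rewrite !(mul0r, mulr0).
  rewrite !mul1r le_eqVlt; apply/orP; left; apply/eqP; congr (_ * (_ * ln _)).
  by field; rewrite !gt_eqF.
rewrite /rate_cost.
apply: le_trans (ler_sum _ (fun a _ => ler_sum _ (fun c _ => term a c))) _.
rewrite le_eqVlt; apply/orP; left; apply/eqP.
under eq_bigr do rewrite big_split /= -!mulr_sumr.
rewrite big_split /= -!mulr_sumr; congr (_ * _ + _ * _).
  rewrite /mutual_info; apply: eq_bigr => a _; apply: eq_bigr => c _.
  by rewrite p_marginal.
apply: eq_bigr => a _; rewrite (bigD1 a) //= eqxx mulr1 big1 ?addr0 // => c /negPf ->.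
by rewrite mulr0 mul0r.
Qed.

End Mixture.

Lemma mean_energy_ge0 : 0 <= mean_energy pE.
Proof. by apply: sumr_ge0 => b _; rewrite mulr_ge0 ?pmf_ge0. Qed.

Lemma achievability (Phat : R) (p : load Xmax -> load Xmax -> R) (d : R) :
  0 <= Phat ->
  (forall a c, 0 <= p a c) -> (forall a, \sum_c p a c = pX a) ->
  (forall a c, 0 < p a c -> 0 <= (a%:R - c%:R : R) <= Phat) ->
  \sum_a \sum_c p a c * (a%:R - c%:R) <= mean_energy pE ->
  0 < d < 1 ->
  exists2 g, feasible pX pE Phat g & exists C, forall n,
    info_known pX pE g n <=
    n%:R * ((1 - d) * mutual_info p + d * input_entropy) + C.
Proof.
move=> Phat0 p0 pm supp mean d01.
have [d0 d1] : 0 < d /\ 0 < 1 - d by rewrite subr_gt0; case/andP: d01.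
pose K := mix_kernel p0 pm d01.
have KE a c : pX a * K a c = (1 - d) * p a c + d * (pX a * (c == a)%:R).
  exact: mix_kernelE.
have Kdiag : forall a, 0 < pX a -> 0 < K a a by exact: mix_kernel_diag.
have Ksum := mix_kernel_sum p0 pm d01; have Krate := rate_cost_mix_le p0 pm d01.
rewrite -/K in Ksum Krate; clearbody K.
exists (store_policy (Emax := Emax) K).
  apply: store_policy_feasible => // a c pa Kac.
  have [h|h] := ltP 0 (p a c); first exact: supp.
  have : 0 < pX a * K a c by rewrite mulr_gt0.
  have -> : pX a * K a c = d * (pX a * (c == a)%:R).
    by rewrite KE (_ : p a c = 0) ?mulr0 ?add0r //; apply/eqP; rewrite eq_le h p0.
  case: eqP => [->|_]; last by rewrite !mulr0 ltxx.
  by rewrite subrr lexx.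
suff [C hC] : exists C, forall n,
    (store_cost pX K - rate_cost pX K) * \sum_(t < n) low_battery pX pE K t <= C.
  exists C => n; apply: le_trans (info_known_store_le pE Kdiag n) _.
  by rewrite lerD // ler_wpM2l.
(* With zero mean energy there is no drift to exploit. The mean draw under [p] is then a sum of
   nonnegative terms that is at most 0, so [p] is diagonal and the two costs coincide. *)
have := mean_energy_ge0; rewrite le_eqVlt => /orP[/eqP mean0|mean_gt0].
  exists 0 => n; suff -> : store_cost pX K = rate_cost pX K by rewrite subrr mul0r.
  have p_diag a c : c != a -> p a c = 0.
    move=> ca; apply/eqP; rewrite eq_le p0 andbT leNgt; apply/negP => pac.
    have t0 a' c' : 0 <= p a' c' * (a'%:R - c'%:R : R).
      have [h|h] := ltP 0 (p a' c'); first by rewrite mulr_ge0 //; have /andP[] := supp _ _ h.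
      by rewrite (_ : p a' c' = 0) ?mul0r //; apply/eqP; rewrite eq_le h p0.
    suff : 0 < \sum_a \sum_c p a c * (a%:R - c%:R) by rewrite ltNge (le_trans mean) // -mean0.
    apply: (sum_gt0 (i := a)) => [a'|]; first exact: sumr_ge0.
    apply: (sum_gt0 (i := c)) => //; rewrite mulr_gt0 // lt0r.
    have /andP[-> _] := supp _ _ pac; rewrite andbT subr_eq0 eqr_nat.
    by rewrite eq_sym.
  have K_diag a c : pX a * K a c = pX a * (c == a)%:R.
    have [ca|ca] := eqVneq c a; last by rewrite KE p_diag // (negPf ca) !mulr0 addr0.
    have -> : pX a * K a c = (1 - d) * p a a + d * pX a by rewrite KE ca eqxx mulr1.
    have -> : p a a = pX a.
      by rewrite -pm (bigD1 a) //= big1 ?addr0 // => c' /p_diag.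
    by rewrite mulr1; ring.
  rewrite /store_cost /rate_cost; apply: eq_bigr => a _.
  under eq_bigr do rewrite K_diag.
  rewrite (bigD1 a) //= eqxx mulr1 big1 ?addr0 => [|c /negPf ->]; last by rewrite mulr0 mul0r.
  have [->|pa] := eqVneq (pX a) 0; first by rewrite !mul0r.
  suff -> : K a a = 1 by [].
  by apply: (mulfI pa); rewrite K_diag eqxx.
have [C hC] : exists C, forall n, \sum_(t < n) low_battery pX pE K t <= C.
  apply: low_battery_summable => //.
  (* The identity part draws nothing, so the mean draw is at most [1 - d] times the positive mean
     energy. *)
  rewrite Ksum.
  rewrite [X in _ + _ * X]big1 ?mulr0 ?addr0 => [|a _]; last by rewrite subrr mulr0.
  have := ler_wpM2l (ltW d1) mean; have := mulr_gt0 d0 mean_gt0; lra.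
(* The absolute value is taken because the cost difference has no known sign. *)
exists (`|store_cost pX K - rate_cost pX K| * C) => n.
apply: le_trans (ler_wpM2l (normr_ge0 _) (hC n)).
rewrite ler_wpM2r ?ler_norm //; apply: sumr_ge0 => t _.
by apply: sumr_ge0 => x _; apply: sumr_ge0 => e _; apply: sumr_ge0 => y _;
   rewrite mulr_ge0 ?joint_law_ge0.
Qed.

Lemma info_unknown_le_known (f : policy R Xmax Emax) n :
  info_unknown pX pE f n <= info_known pX pE f n.
Proof.
apply: (mutual_info_le_cond (pA := fun x : n.-tuple _ => \prod_(t < n) pX (tnth x t))
  (pC := fun e : n.-tuple _ => \prod_(t < n) pE (tnth e t))).
- by move=> *; exact: joint_law_ge0.
- by move=> x; apply: prodr_ge0 => t _; exact: pmf_ge0.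
- by move=> x; apply: prodr_ge0 => t _; exact: pmf_ge0.
- by rewrite (sum_tuple_prod n (fun _ => pX)) big1 // => t _; exact: pmf_sum1.
- by rewrite (sum_tuple_prod n (fun _ => pE)) big1 // => t _; exact: pmf_sum1.
- by move=> x e; exact: sum_joint_law.
Qed.

Lemma min_leakage_known_le (Phat : R) (f : policy R Xmax Emax) (M : R) :
  0 <= Phat -> feasible pX pE Phat f -> (rate_unknown pX pE f < M%:E)%E ->
  (min_leakage_known pX pE Phat <= M%:E)%E.
Proof.
move=> Phat0 feas /limn_esup_lt_exists[n n_gt0]; rewrite lte_fin => In.
have [p [p0 pm supp mean pI]] := single_letter_converse n_gt0 feas.
set J := mutual_info p in pI; set H := input_entropy.
have n0 : 0 < n%:R :> R by rewrite ltr0n.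
have JM : J < M.
  apply: le_lt_trans In; rewrite mulrC ler_pdivlMr // mulrC; exact: pI.
apply/lee_addgt0Pr => e e0.
(* The term [|H - J|] gives [d * (H - J) <= e / 2]; the terms [1 + e] keep the denominator above
   [e], so [d < 1]. *)
pose d := e / (2 * (1 + e + `|H - J|)).
have nHJ := normr_ge0 (H - J).
have den : 0 < 2 * (1 + e + `|H - J|) by lra.
have d0 : 0 < d by rewrite divr_gt0.
have dE : d * (2 * (1 + e + `|H - J|)) = e by rewrite divfK // gt_eqF.
have d1 : d < 1 by rewrite ltr_pdivrMr //; lra.
have d01 : 0 < d < 1 by rewrite d0.
have dHJ : d * (H - J) <= e / 2.
  have := ler_wpM2l (ltW d0) (ler_norm (H - J)); have := mulr_gt0 d0 e0; lra.
have [g gf [C gC]] := achievability Phat0 p0 pm supp mean d01.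
apply: le_trans (_ : (rate_known pX pE g <= _)%E).
  by apply: ereal_inf_lbound; exists g.
(* From this index on [C <= e / 2 * k], so the other half of [e] absorbs the constant; the successor
   keeps [k] positive. *)
apply: (@limn_esup_ge_near _ _ _ (Num.truncn (2 * `|C| / e)).+1) => k Nk.
rewrite -EFinD lee_fin.
have k0 : 0 < k%:R :> R by rewrite ltr0n (leq_trans _ Nk).
rewrite mulrC ler_pdivrMr //; apply: le_trans (gC k) _; rewrite -/J -/H.
have : C <= e / 2 * k%:R.
  apply: le_trans (ler_norm C) _.
  have : 2 * `|C| / e <= k%:R.
    apply: le_trans (ltW (truncnS_gt _)) _; by rewrite ler_nat.
  by rewrite ler_pdivrMr // => h; lra.
have : k%:R * ((1 - d) * J + d * H) <= k%:R * (M + e / 2).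
  by rewrite ler_wpM2l ?ltW //; lra.
lra.
Qed.

End Achievability.

Theorem theorem3 (R : realType) (Xmax Emax : nat)
    (pX : dist R (load Xmax)) (pE : dist R (energy Emax)) (Phat : R)
    (hPhat : mean_energy pE <= Phat) :
  min_leakage_known pX pE Phat = min_leakage_unknown pX pE Phat.
Proof.
have Phat0 : 0 <= Phat := le_trans (mean_energy_ge0 pE) hPhat.
apply/eqP; rewrite eq_le; apply/andP; split.
  apply: le_ereal_inf_tmp => _ [f feas <-].
  case E : (rate_unknown pX pE f) => [r| |].
  - apply/lee_addgt0Pr => e e0; apply: (min_leakage_known_le Phat0 feas).
    by rewrite E lte_fin ltrDl.
  - exact: leey.
  (* The value [-oo] is not excluded in advance: in that case every real bounds the known-energy
     leakage, which is then [-oo] too. *)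
  - have below M : (min_leakage_known pX pE Phat <= M%:E)%E.
      by apply: (min_leakage_known_le Phat0 feas); rewrite E ltNyr.
    case: (min_leakage_known pX pE Phat) below => [r /(_ (r - 1))|/(_ 0)|//].
      by rewrite lee_fin => h; exfalso; lra.
    by rewrite leye_eq.
apply: le_ereal_inf_tmp => _ [f feas <-].
apply: (@le_trans _ _ (rate_unknown pX pE f)).
  by apply: ereal_inf_lbound; exists f.
apply: le_limn_esup => n; rewrite lee_fin ler_wpM2l ?invr_ge0 //.
exact: info_unknown_le_known.
Qed.
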